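(* Let $G$ be a graph on $n$ vertices, $\ell$ a positive integer, and $M\subseteq V(G)$ with $|M|=k$ such that $Q=G-M$ is a clique with $|V(Q)|>k$, and assume $n\le\ell+k$. Construct the bipartite graph $B$ and the matrix $A$ as follows. Let $C=\{c_1,\dots,c_\ell\}$, $C'=\{c'_v: v\in M\}$, and let $V'$ be a set of $\ell+k-n$ new (artificial) vertices. $B$ has bipartition $(V(G)\cup V',\,C\cup C')$, with edges: every $v\in V(G)$ is adjacent to all of $C$; each $v\in M$ is additionally adjacent to $c'_v$; every vertex of $V'$ is adjacent to all of $C\cup C'$. For each edge $(v,c)$ of $B$ define $\mathcal{S}_{(v,c)}\subseteq 2^M\times 2^M$: if $v\in V(Q)$ and $c\in C$, it consists of all pairs $(S_1,S_2)$ with $S_1\subseteq M$, $S_1\cup\{v\}$ independent in $G$, and $S_2=\{u\in M: N_G[u]\supseteq S_1\cup\{v\}\}$; if $v\in M$ and $c\in C$, it consists of all pairs $(S_1,S_2)$ with $S_1\subseteq M$ independent in $G$, $v\in S_1$, and $S_2=\{u\in M:N_G[u]\supseteq S_1\}$; if $v\in V'$ or $c\in C'$, then $\mathcal{S}_{(v,c)}=\{(\emptyset,\emptyset)\}$. With variables $x_u,y_u$ ($u\in M$) and $z_{(v,c)}$ (edges of $B$), let $P(v,c)=\sum_{(S_1,S_2)\in\mathcal{S}_{(v,c)}}\prod_{s\in S_1}x_s\prod_{s\in S_2}y_s$ (empty products equal $1$), and let $A$ be the square matrix with rows indexed by $V(G)\cup V'$ and columns by $C\cup C'$, with $A(v,c)=z_{(v,c)}P(v,c)$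 if $(v,c)\in E(B)$ and $A(v,c)=0$ otherwise. Then $G$ has a dominator coloring with at most $\ell$ colors if and only if the polynomial $\det A$ (over $\mathbb{R}$) contains a monomial divisible by $\prod_{u\in M}x_u y_u$.
   Context: Graphs are finite and simple; $N_G[v]=N_G(v)\cup\{v\}$. A proper coloring assigns different colors to adjacent vertices. A vertex $v$ dominates a set $T$ if $T\subseteq N_G[v]$. A dominator coloring of $G$ is a proper coloring in which every vertex dominates some color class. *)

(* Defs.v *)
From HB Require Import structures.
From mathcomp Require Import all_boot all_order all_algebra reals.
From mathcomp Require Import mpoly.

Set Implicit Arguments.
Unset Strict Implicit.
Unset Printing Implicit Defensive.

Import GRing.Theory.
Local Open Scope ring_scope.

Record sgraph := SGraph {
  vertex :> finType;
  adj : rel vertex;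
  adj_sym : ssrbool.symmetric adj;
  adj_irrefl : irreflexive adj }.

Section Graphs.
Variable G : sgraph.
Implicit Types (u v : G) (S : {set G}).

Definition closed_nbhd v : {set G} := v |: [set u | adj v u].

Definition clique S := [forall u in S, forall v in S, (u != v) ==> adj u v].

Definition independent S := [forall u in S, forall v in S, ~~ adj u v].

Definition dominates v S := S \subset closed_nbhd v.

Definition proper_coloring (C : finType) (f : {ffun G -> C}) :=
  forall u v, adj u v -> f u != f v.

Definition color_class (C : finType) (f : {ffun G -> C}) (c : C) : {set G} :=
  [set v | f v == c].

(* Only the colors actually used give color classes: an unused color would
   have an empty class, which every vertex dominates vacuously. *)
Definition dominator_coloring (C : finType) (f : {ffun G -> C}) :=
  proper_coloring f /\
  forall v, exists2 c, c \in codom f & dominates v (color_class f c).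

End Graphs.

Section Construction.
Variables (G : sgraph) (M : {set G}) (l : nat).

Definition modvertex : finType := {u : G | u \in M}.

(* V(G) + V'; the truncated subtraction is exact when #|G| <= l + #|M|. *)
Definition rowB : finType := (G + 'I_(l + #|M| - #|G|))%type.

(* C + C' *)
Definition colB : finType := ('I_l + modvertex)%type.

Definition adjB (v : rowB) (c : colB) : bool :=
  match v, c with
  | inl _, inl _ => true
  | inl w, inr u => w == val u
  | inr _, _     => true
  end.

Definition edgeB : finType := {e : rowB * colB | adjB e.1 e.2}.

Definition dominators_in (S : {set G}) : {set G} := [set u in M | dominates u S].

(* Used only when adjB v c holds. *)
Definition pairs (v : rowB) (c : colB) : {set {set G} * {set G}} :=
  match v, c with
  | inl w, inl _ =>
      if w \in M then
        [set S : {set G} * {set G} | [&& S.1 \subset M, independent S.1, w \in S.1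
                   & S.2 == dominators_in S.1]]
      else
        [set S : {set G} * {set G} | [&& S.1 \subset M, independent (w |: S.1)
                   & S.2 == dominators_in (w |: S.1)]]
  | _, _ => [set (set0, set0)]
  end.

(* The indeterminates x_u, y_u (u in M) and z_e (e an edge of B). *)
Definition indet : finType := (modvertex + modvertex + edgeB)%type.

Definition xvar (u : modvertex) : 'I_#|indet| :=
  enum_rank (inl (inl u) : indet).
Definition yvar (u : modvertex) : 'I_#|indet| :=
  enum_rank (inl (inr u) : indet).
Definition zvar (e : edgeB) : 'I_#|indet| := enum_rank (inr e : indet).

Definition xy_monomial : 'X_{1..#|indet|} :=
  (\big[+%MM/0%MM]_(u : modvertex) (U_(xvar u) + U_(yvar u)))%MM.

Section Polynomials.
Variable R : realType.

Definition edge_poly (v : rowB) (c : colB) : {mpoly R[#|indet|]} :=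
  \sum_(S in pairs v c)
     (\prod_(s : modvertex | val s \in S.1) 'X_(xvar s)) *
     (\prod_(s : modvertex | val s \in S.2) 'X_(yvar s)).

Definition entryA (v : rowB) (c : colB) : {mpoly R[#|indet|]} :=
  if insub (v, c) is Some e then 'X_(zvar e) * edge_poly v c else 0.

(* The matrix with rows rowB and columns colB, listed in the orders given by
   the bijections er and ec; changing them only affects the sign of the
   determinant. *)
Definition matA (er : 'I_(l + #|M|) -> rowB) (ec : 'I_(l + #|M|) -> colB) :
    'M[{mpoly R[#|indet|]}]_(l + #|M|) :=
  \matrix_(i, j) entryA (er i) (ec j).

End Polynomials.

Lemma card_modvertex : #|modvertex| = #|M|.
Proof. by rewrite card_sig; apply: eq_card => u; rewrite inE. Qed.

Lemma bij_ord (T : finType) n : #|T| = n -> exists f : 'I_n -> T, bijective f.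
Proof.
by move=> <-; exists enum_val; exists enum_rank; [exact: enum_valK | exact: enum_rankK].
Qed.

(* The orderings required by matA exist. *)
Lemma rowB_ordering : (#|G| <= l + #|M|)%N ->
  exists er : 'I_(l + #|M|) -> rowB, bijective er.
Proof. by move=> le_n; apply: bij_ord; rewrite card_sum card_ord subnKC. Qed.

Lemma colB_ordering : exists ec : 'I_(l + #|M|) -> colB, bijective ec.
Proof. by apply: bij_ord; rewrite card_sum card_ord card_modvertex. Qed.

End Construction.

(* Main.v *)
(** The terms of [\det A] are indexed by the perfect matchings of B together with
    a choice of a pair (S1, S2) on every matched edge. The z-variables of a term
    determine its matching and terms of the same matching have the same sign, so
    nothing cancels; hence a monomial divisible by all x_u y_u exists iff some
    choice covers M both by its sets S1 and by its sets S2.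

    From a coloring, match each used color to a representative of its class (the
    vertex of Q, if any), each other v in M to c'_v, and the remaining columns to
    V'. Conversely, a vertex matched to a color c gets color c, and any other
    vertex gets the color of some S1 containing it: classes shrink but stay
    nonempty, so they are still dominated. Since |Q| > |M|, some vertex of Q is
    alone in its class, and it is dominated by all of Q. *)
Require Import Defs.
From mathcomp Require Import all_boot all_order all_fingroup all_algebra reals.
From mathcomp Require Import mpoly.

Set Implicit Arguments.
Unset Strict Implicit.
Unset Printing Implicit Defensive.

Import Order.TTheory GRing.Theory Num.Theory.

Section Expansion.
Local Open Scope ring_scope.
Variables (R : realType) (G : sgraph) (M : {set G}) (l : nat).
Implicit Types (v : rowB M l) (c : colB M l).

Definition edge_pairs v c : {set {set G} * {set G}} :=
  if adjB v c then pairs v c else set0.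

Definition z_monomial v c : 'X_{1..#|indet M l|} :=
  if insub (v, c) is Some e then U_(zvar e)%MM else 0%MM.

Definition edge_monomial v c (S : {set G} * {set G}) : 'X_{1..#|indet M l|} :=
  (z_monomial v c +
   (\big[+%MM/0%MM]_(s : modvertex M | val s \in S.1) U_(xvar l s) +
    \big[+%MM/0%MM]_(s : modvertex M | val s \in S.2) U_(yvar l s)))%MM.

Lemma mpolyX_sum (n : nat) (I : finType) (P : pred I) (F : I -> 'X_{1..n}) :
  'X_[\big[+%MM/0%MM]_(i | P i) F i] = \prod_(i | P i) 'X_[F i] :> {mpoly R[n]}.
Proof. exact: (big_morph _ (@mpolyXD n R) (mpolyX0 n R)). Qed.

Lemma entryA_sum v c :
  entryA R v c = \sum_(S in edge_pairs v c) 'X_[edge_monomial v c S].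
Proof.
rewrite /entryA /edge_pairs /edge_monomial /z_monomial.
case: insubP => [e adj_e _|/negbTE /= ->]; last by rewrite big_set0.
rewrite /= in adj_e; rewrite adj_e /edge_poly mulr_sumr.
by apply: eq_bigr => S _; rewrite !mpolyXD !mpolyX_sum.
Qed.

Lemma sum_pred1 (T : finType) (P : pred T) (u : T) :
  (\sum_(s | P s) (s == u) = P u :> nat)%N.
Proof.
rewrite big_mkcond (bigD1 u) //= eqxx big1 => [|s /negbTE ->]; last by case: ifP.
by rewrite addn0; case: (P u).
Qed.

Lemma edge_monomial_x v c S u :
  edge_monomial v c S (xvar l u) = (val u \in S.1) :> nat.
Proof.
rewrite !mnmDE !mnm_sumE -(sum_pred1 (fun s => val s \in S.1) u).
rewrite [X in (_ + (_ + X))%N]big1 => [|s _]; last first.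
  by rewrite mnm1E (inj_eq enum_rank_inj).
have -> : z_monomial v c (xvar l u) = 0%N.
  rewrite /z_monomial; case: insub => [e|]; last by rewrite mnm0E.
  by rewrite mnm1E (inj_eq enum_rank_inj).
rewrite addn0 add0n.
by apply: eq_bigr => s _; rewrite mnm1E (inj_eq enum_rank_inj).
Qed.

Lemma edge_monomial_y v c S u :
  edge_monomial v c S (yvar l u) = (val u \in S.2) :> nat.
Proof.
rewrite !mnmDE !mnm_sumE -(sum_pred1 (fun s => val s \in S.2) u).
rewrite [X in (_ + (X + _))%N]big1 => [|s _]; last first.
  by rewrite mnm1E (inj_eq enum_rank_inj).
have -> : z_monomial v c (yvar l u) = 0%N.
  rewrite /z_monomial; case: insub => [e|]; last by rewrite mnm0E.
  by rewrite mnm1E (inj_eq enum_rank_inj).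
rewrite !add0n.
by apply: eq_bigr => s _; rewrite mnm1E (inj_eq enum_rank_inj).
Qed.

Lemma edge_monomial_z v c S (e : edgeB M l) :
  edge_monomial v c S (zvar e) = ((v, c) == val e) :> nat.
Proof.
rewrite !mnmDE !mnm_sumE /z_monomial.
rewrite !big1 ?addn0 => [|s _|s _]; try by rewrite mnm1E (inj_eq enum_rank_inj).
case: insubP => [e' _ <-|nadj].
  by rewrite mnm1E (inj_eq enum_rank_inj).
by rewrite mnm0E; case: eqP nadj => // ->; rewrite (valP e).
Qed.

Lemma xy_monomial_le (m : 'X_{1..#|indet M l|}) :
  reflect (forall u : modvertex M, (0 < m (xvar l u))%N /\ (0 < m (yvar l u))%N)
          (xy_monomial M l <= m)%MM.
Proof.
have xyE i : xy_monomial M l i =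
    (\sum_(u : modvertex M) ((xvar l u == i) + (yvar l u == i)))%N.
  by rewrite mnm_sumE; apply: eq_bigr => u _; rewrite mnmDE !mnm1E.
have xyx u : xy_monomial M l (xvar l u) = 1%N.
  rewrite xyE big_split /= [X in (_ + X)%N]big1 ?addn0 => [|s _]; last first.
    by rewrite (inj_eq enum_rank_inj).
  rewrite -[RHS]/(nat_of_bool (xpredT u)) -(sum_pred1 xpredT u).
  by apply: eq_bigr => s _; rewrite (inj_eq enum_rank_inj).
have xyy u : xy_monomial M l (yvar l u) = 1%N.
  rewrite xyE big_split /= [X in (X + _)%N]big1 ?add0n => [|s _]; last first.
    by rewrite (inj_eq enum_rank_inj).
  rewrite -[RHS]/(nat_of_bool (xpredT u)) -(sum_pred1 xpredT u).
  by apply: eq_bigr => s _; rewrite (inj_eq enum_rank_inj).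
have xyz e : xy_monomial M l (zvar e) = 0%N.
  by rewrite xyE big1 // => s _; rewrite !(inj_eq enum_rank_inj).
apply: (iffP mnm_lepP) => [le_m u|pos_m i].
  by rewrite -{1}(xyx u) -{1}(xyy u) !le_m.
rewrite -[i]enum_valK; case: (enum_val i) => [[u|u]|e].
- by rewrite -/(xvar l u) xyx; case: (pos_m u).
- by rewrite -/(yvar l u) xyy; case: (pos_m u).
- by rewrite -/(zvar e) xyz.
Qed.

Variables (er : 'I_(l + #|M|) -> rowB M l) (ec : 'I_(l + #|M|) -> colB M l).
Hypotheses (er_inj : injective er) (ec_inj : injective ec).

Definition expansion_monomial (s : 'S_(l + #|M|))
    (S : {ffun 'I_(l + #|M|) -> {set G} * {set G}}) : 'X_{1..#|indet M l|} :=
  (\big[+%MM/0%MM]_i edge_monomial (er i) (ec (s i)) (S i))%MM.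

Definition expansion_choices (s : 'S_(l + #|M|)) :=
  family (fun i => mem (edge_pairs (er i) (ec (s i)))).

Lemma mcoeff_det_matA m :
  (\det (matA R er ec))@_m =
  \sum_(s : 'S_(l + #|M|)) (-1) ^+ s *
    (\sum_(S in expansion_choices s) (expansion_monomial s S == m)%:R).
Proof.
rewrite /determinant raddf_sum /=; apply: eq_bigr => s _.
have -> : (-1) ^+ s = ((-1) ^+ s)%:MP :> {mpoly R[#|indet M l|]}.
  by rewrite rmorphXn /= rmorphN1.
rewrite mcoeffCM; congr (_ * _).
rewrite (eq_bigr (fun i => \sum_(S in edge_pairs (er i) (ec (s i)))
    'X_[edge_monomial (er i) (ec (s i)) S])); last first.
  by move=> i _; rewrite mxE entryA_sum.
rewrite bigA_distr_big_dep raddf_sum /=; apply: eq_bigr => S _.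
by rewrite -mpolyX_sum mcoeffX.
Qed.

(* The z-variables of a term identify its permutation. *)
Lemma expansion_monomial_inj s s' S S' :
  S \in expansion_choices s ->
  expansion_monomial s S = expansion_monomial s' S' -> s = s'.
Proof.
move=> /familyP famS eq_m; apply/permP => i.
have adj_i : adjB (er i) (ec (s i)).
  by have := famS i; rewrite /edge_pairs; case: ifP => //; rewrite inE.
pose e : edgeB M l := Sub (er i, ec (s i)) adj_i.
have /mnmP/(_ (zvar e)) := eq_m.
rewrite !mnm_sumE (bigD1 i) //= edge_monomial_z eqxx add1n => /esym nz.
have: (\sum_j edge_monomial (er j) (ec (s' j)) (S' j) (zvar e) != 0)%N by rewrite nz.
rewrite sum_nat_eq0 negb_forall => /existsP[j] /=.
by rewrite edge_monomial_z eqb0 negbK => /eqP[/er_inj -> /ec_inj ->].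
Qed.

Lemma msupp_det_matA m :
  m \in msupp (\det (matA R er ec)) <->
  exists s S, S \in expansion_choices s /\ expansion_monomial s S = m.
Proof.
rewrite mcoeff_msupp mcoeff_det_matA; split=> [|[s [S [chS mE]]]].
  case: (boolP [exists s, exists S,
      (S \in expansion_choices s) && (expansion_monomial s S == m)]).
    by case/existsP=> s /existsP[S /andP[chS /eqP mE]] _; exists s, S.
  rewrite negb_exists => /forallP none; rewrite big1 ?eqxx // => s _.
  rewrite big1 ?mulr0 // => S chS; have := none s.
  by rewrite negb_exists => /forallP/(_ S); rewrite chS /= => /negbTE ->.
rewrite (bigD1 s) //= [X in _ + X]big1 => [|s' ne_s]; last first.
  rewrite big1 ?mulr0 // => S' chS'; case: eqP => // mE'.
  by rewrite (expansion_monomial_inj chS' (etrans mE' (esym mE))) eqxx in ne_s.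
rewrite addr0 mulf_neq0 ?signr_eq0 // (bigD1 S) //= mE eqxx.
by rewrite gt_eqF // ltr_wpDr // sumr_ge0.
Qed.

End Expansion.

Section Matchings.
Variables (G : sgraph) (M : {set G}) (l : nat).

Definition covering_matching (t : rowB M l -> colB M l)
    (p : rowB M l -> {set G} * {set G}) :=
  [/\ injective t, forall v, p v \in edge_pairs v (t v) &
      forall u, u \in M -> (exists v, u \in (p v).1) /\ (exists v, u \in (p v).2)].

Lemma det_matA_covering (R : realType)
    (er : 'I_(l + #|M|) -> rowB M l) (ec : 'I_(l + #|M|) -> colB M l) :
  bijective er -> bijective ec ->
  (exists2 m, m \in msupp (\det (matA R er ec))%R & (xy_monomial M l <= m)%MM) <->
  (exists t p, covering_matching t p).
Proof.
move=> er_bij ec_bij; case: (er_bij) (ec_bij) => [er' erK er'K] [ec' ecK ec'K].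
have supp m := msupp_det_matA R (bij_inj er_bij) (bij_inj ec_bij) m.
have sum_pos (I : finType) (P : pred I) : (0 < \sum_i P i) = [exists i, P i].
  rewrite lt0n sum_nat_eq0 negb_forall; apply: eq_existsb => i.
  by rewrite eqb0 negbK.
split=> [[m /supp[s [S [/familyP famS mE]]] /xy_monomial_le pos]|[t [p [t_inj p_in cov]]]].
  exists (fun v => ec (s (er' v))), (fun v => S (er' v)); split.
  - move=> v w /(bij_inj ec_bij)/perm_inj eq_vw.
    by rewrite -[v]er'K eq_vw er'K.
  - by move=> v; have := famS (er' v); rewrite er'K.
  - move=> u uM; have [] := pos (Sub u uM); rewrite -mE !mnm_sumE.
    under eq_bigr do rewrite edge_monomial_x.
    under [X in _ -> 0 < X -> _]eq_bigr do rewrite edge_monomial_y.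
    rewrite !sum_pos => /existsP[i ui] /existsP[j uj].
    by split; [exists (er i) | exists (er j)]; rewrite erK.
pose s0 i := ec' (t (er i)).
have s0_inj : injective s0.
  by move=> i j /(can_inj ec'K)/t_inj/(bij_inj er_bij).
pose s := perm s0_inj; pose S := [ffun i => p (er i)].
have chS : S \in expansion_choices er ec s.
  by apply/familyP => i; rewrite permE ffunE ec'K; apply: p_in.
exists (expansion_monomial er ec s S); first by apply/supp; exists s, S.
apply/xy_monomial_le => u; have [[v uv] [w uw]] := cov _ (valP u).
rewrite !mnm_sumE.
under eq_bigr do rewrite edge_monomial_x ffunE.
under [X in _ /\ 0 < X]eq_bigr do rewrite edge_monomial_y ffunE.
by rewrite !sum_pos; split; apply/existsP; [exists (er' v) | exists (er' w)]; rewrite er'K.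
Qed.

Lemma extend_injection (A C : finType) (n : nat) (g : A -> C) :
  injective g -> #|C| = #|A| + n ->
  exists2 t : A + 'I_n -> C, injective t & forall a, t (inl a) = g a.
Proof.
move=> g_inj card_C.
have card_n : n = #|[predC codom g]|.
  by apply: (@addnI #|A|); rewrite -card_C -(card_codom g_inj) cardC.
exists (fun v => match v with inl a => g a | inr i => enum_val (cast_ord card_n i) end) => //.
move=> [a|i] [b|j] /=.
- by move/g_inj->.
- move=> gE; have := enum_valP (cast_ord card_n j).
  by rewrite -gE inE /= codom_f.
- move=> gE; have := enum_valP (cast_ord card_n i).
  by rewrite gE inE /= codom_f.
- by move/enum_val_inj/cast_ord_inj->.
Qed.

Hypothesis cliqueQ : clique (~: M).

Lemma coloring_injQ (f : {ffun G -> 'I_l}) :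
  proper_coloring f -> {in ~: M &, injective f}.
Proof.
move=> proper_f u v uQ vQ fuv; apply/eqP; apply: contraT => ne_uv.
have /forall_inP/(_ u uQ)/forall_inP/(_ v vQ) := cliqueQ; rewrite ne_uv /=.
by move/proper_f; rewrite fuv eqxx.
Qed.

Lemma color_class_independent (f : {ffun G -> 'I_l}) c :
  proper_coloring f -> independent (color_class f c).
Proof.
move=> proper_f; apply/forall_inP => u; rewrite inE => /eqP fu.
apply/forall_inP => v; rewrite inE => /eqP fv.
by apply/negP => /proper_f; rewrite fu fv eqxx.
Qed.

(* A color is matched to the Q-vertex of its class if there is one, and
   otherwise to an arbitrary vertex of its class. *)
Lemma covering_of_dominator_coloring (f : {ffun G -> 'I_l}) :
  #|G| <= l + #|M| -> dominator_coloring f ->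
  exists t p, covering_matching t p.
Proof.
move=> le_n [proper_f dom_f].
pose r c := if [pick v | (f v == c) && (v \notin M)] is Some v then Some v
            else [pick v | f v == c].
have rP w : exists2 v, r (f w) = Some v & f v = f w.
  rewrite /r; case: pickP => [v /andP[/eqP fv _]|_]; first by exists v.
  by case: pickP => [v /eqP|/(_ w)]; [exists v | rewrite eqxx].
have rQ w : w \notin M -> r (f w) = Some w.
  move=> wQ; rewrite /r; case: pickP => [v /andP[/eqP fv vQ]|/(_ w)].
    by congr Some; apply: (coloring_injQ proper_f); rewrite ?inE.
  by rewrite eqxx wQ.
pose cls w := color_class f (f w).
pose g (w : G) : colB M l :=
  if r (f w) == Some w then inl (f w)
  else if insub w is Some u then inr u else inl (f w).
have gP w : (r (f w) = Some w /\ g w = inl (f w)) \/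
    (exists2 u : modvertex M, val u = w & r (f w) <> Some w /\ g w = inr u).
  rewrite /g; case: eqP => [rw|nrw]; [by left | right].
  case: insubP => [u _ uw|/rQ //]; by exists u.
have g_inj : injective g.
  move=> v w; case: (gP v) => [[rv ->]|[u uv [_ ->]]];
    case: (gP w) => [[rw ->]|[u' uw [_ ->]]] // [].
    by move=> fvw; move: rv; rewrite fvw rw => -[].
  by move=> uu'; rewrite -uv -uw uu'.
have card_col : #|colB M l| = #|G| + (l + #|M| - #|G|).
  by rewrite subnKC // card_sum card_ord card_modvertex.
have [t t_inj tE] := extend_injection g_inj card_col.
pose p (v : rowB M l) : {set G} * {set G} :=
  if v is inl w then
    if r (f w) == Some w then
      (if w \in M then cls w else cls w :\ w, dominators_in M (cls w))
    else (set0, set0)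
  else (set0, set0).
exists t, p; split=> // [[w|i]|u uM].
- rewrite /edge_pairs tE /p; case: (gP w) => [[rw ->]|[u uw [/eqP/negbTE -> ->]]] /=; last first.
    by rewrite uw eqxx inE.
  have indep := color_class_independent (f w) proper_f.
  have clsM v : v \in cls w -> v <> w -> v \in M.
    rewrite inE => /eqP fvw ne_vw; apply: contraT => /rQ.
    by rewrite fvw rw => -[/esym].
  have wcls : w \in cls w by rewrite inE.
  rewrite rw eqxx; case: ifP => wM; rewrite inE /=.
    rewrite indep wcls eqxx !andbT; apply/subsetP => v vcls.
    by case: (eqVneq v w) => [->|/eqP/(clsM v vcls)].
  rewrite setD1K // indep eqxx !andbT; apply/subsetP => v.
  by rewrite in_setD1 => /andP[/eqP ne_vw /clsM]; apply.
- by rewrite /edge_pairs /p; case: (t (inr i)) => ? /=; rewrite inE.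
split.
  have [v rv fv] := rP u; exists (inl v); rewrite /p fv rv eqxx /=.
  case: ifP => vM; rewrite ?in_setD1 inE fv eqxx // andbT.
  by apply: contraTneq uM => ->; rewrite vM.
have [c /codomP[w ->] dom_u] := dom_f u; have [v rv fv] := rP w.
by exists (inl v); rewrite /p fv rv eqxx /= inE uM /cls fv.
Qed.

Lemma dominator_coloring_of_covering t p :
  #|M| < #|~: M| -> covering_matching t p ->
  exists f : {ffun G -> 'I_l}, dominator_coloring f.
Proof.
move=> ltMQ [t_inj p_in cov].
pose K x := x |: (p (inl x)).1.
have pC x c : t (inl x) = inl c ->
    independent (K x) /\ (p (inl x)).2 = dominators_in M (K x).
  move=> tx; have := p_in (inl x); rewrite /edge_pairs tx /= /K.
  case: ifP => xM; rewrite inE.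
    by case/and4P=> _ indep xS /eqP ->; rewrite (setUidPr _) ?sub1set.
  by case/and3P=> _ indep /eqP ->.
have p0 v : p v = (set0, set0) \/ exists x c, v = inl x /\ t v = inl c.
  have := p_in v; rewrite /edge_pairs.
  case: v (t v) => [x|i] [c|u] /=; first by right; exists x, c.
  - by case: eqP => _ /[!inE] // /eqP; left.
  - by move=> /[!inE] /eqP; left.
  - by move=> /[!inE] /eqP; left.
have tQ x : x \notin M -> exists c, t (inl x) = inl c.
  move=> xQ; have := p_in (inl x); rewrite /edge_pairs.
  case: (t (inl x)) => [c|u] /=; first by exists c.
  by case: eqP => [xu|_]; rewrite inE // xu (valP u) in xQ *.
have /fin_all_exists[g /fin_all_exists[f0 gP]] w : exists x c,
    [/\ t (inl x) = inl c, w \in K x &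
        forall d, t (inl w) = inl d -> x = w].
  case tw: (t (inl w)) => [c|u]; first by exists w, c; rewrite /K setU11.
  have wM : w \in M by apply: contraT => /tQ[c]; rewrite tw.
  have [[v wv] _] := cov w wM.
  case: (p0 v) => [pv|[x [c [vx tv]]]]; first by rewrite pv inE in wv.
  by exists x, c; rewrite -vx tv /K inE -vx wv orbT.
pose f := [ffun w => f0 w].
have f_g u v : f u = f v -> g u = g v.
  rewrite !ffunE => fuv; have [tu _ _] := gP u; have [tv _ _] := gP v.
  by apply: (@inl_inj _ _); apply: t_inj; rewrite tu tv fuv.
have class_sub x c : t (inl x) = inl c ->
    c \in codom f /\ color_class f c \subset K x.
  move=> tx; have [t_gx _ /(_ _ tx) gx] := gP x.
  have fx : f x = c by move: t_gx; rewrite gx tx ffunE => -[].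
  split; first by rewrite -fx codom_f.
  apply/subsetP => w; rewrite inE -fx => /eqP/f_g; rewrite gx => <-.
  by have [] := gP w.
have proper_f : proper_coloring f.
  move=> u v adj_uv; apply/eqP => /f_g guv.
  have [tu Ku _] := gP u; have [_ Kv _] := gP v.
  have [/forall_inP/(_ u Ku)/forall_inP/(_ v)] := pC _ _ tu.
  by rewrite guv Kv adj_uv => /(_ isT).
exists f; split=> // v; case: (boolP (v \in M)) => [vM|vQ].
  have [_ [w vw]] := cov v vM.
  case: (p0 w) => [pw|[x [c [wx tw]]]]; first by rewrite pw inE in vw.
  rewrite {}wx in vw tw; have [_ p2] := pC _ _ tw.
  have [c_used sub] := class_sub _ _ tw; exists c => //.
  by move: vw; rewrite p2 inE => /andP[_]; apply: subset_trans.
case: (boolP [exists q in ~: M, color_class f (f q) == [set q]]).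
  case/exists_inP=> q qQ /eqP cls_q; exists (f q); first exact: codom_f.
  rewrite /dominates cls_q sub1set !inE; case: eqVneq => //= ne_qv.
  have /forall_inP/(_ v)/[!inE]/(_ vQ)/forall_inP/(_ q qQ) := cliqueQ.
  by rewrite eq_sym ne_qv.
(* Otherwise every vertex of Q shares its color with a vertex of M,
   and distinct vertices of Q have distinct colors. *)
rewrite negb_exists_in => /forall_inP no_single.
have /fin_all_exists[h hP] q : exists u, q \in ~: M -> u \in M /\ f u = f q.
  case: (boolP (q \in ~: M)) => [qQ|_]; last by exists q.
  have [u] : exists u, u \in color_class f (f q) :\ q.
    apply/set0Pn; apply: contra (no_single q qQ) => /eqP cls0.
    by rewrite -(setD1K (_ : q \in color_class f (f q))) ?inE // cls0 setU0.
  rewrite !inE => /andP[ne_uq /eqP fuq]; exists u => _; split=> //.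
  apply: contraT => uQ; case/eqP: ne_uq.
  by apply: (coloring_injQ proper_f) => //; rewrite inE.
have h_inj : {in ~: M &, injective h}.
  move=> q q' qQ q'Q hqq'; apply: (coloring_injQ proper_f) => //.
  by have [_ <-] := hP q qQ; rewrite hqq'; case: (hP q' q'Q).
move: ltMQ; rewrite -(card_in_imset h_inj) ltnNge subset_leq_card //.
by apply/subsetP => _ /imsetP[q qQ ->]; case: (hP q qQ).
Qed.

End Matchings.

Theorem theorem6 (R : realType) (G : sgraph) (l : nat) (M : {set G})
    (er : 'I_(l + #|M|) -> rowB M l) (ec : 'I_(l + #|M|) -> colB M l) :
  0 < l ->
  clique (~: M) ->
  #|M| < #|~: M| ->
  #|G| <= l + #|M| ->
  bijective er ->
  bijective ec ->
  (exists f : {ffun G -> 'I_l}, dominator_coloring f) <->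
  (exists2 m, m \in msupp (\det (matA R er ec)) & (xy_monomial M l <= m)%MM).
Proof.
move=> _ cliqueQ ltMQ le_n er_bij ec_bij.
rewrite det_matA_covering //; split=> [[f]|[t [p]]].
  exact: covering_of_dominator_coloring.
exact: dominator_coloring_of_covering.
Qed.
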